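(* Let $\lambda=(\lambda_1,\dots,\lambda_\ell)\vdash n$ be a partition of $n\ge1$ with Frobenius coordinates $(a_1,\dots,a_d\mid b_1,\dots,b_d)$, and set $a_{d+1}:=-1$. Then $$\eta^\lambda_1=(-1)^n\sum_{i:\ i\le\lambda_i+1}(-1)^{\lambda_i}\,p_{\lambda_1,\,a_1-a_i}\,H_i^+(\lambda),$$ where the sum is over rows $1\le i\le\ell$ with $i\le\lambda_i+1$.
   Context: Eigenvalues. $\eta^\lambda_1=\sum_{\mu\vdash n,\ \mu\text{ has no part equal to }1}\theta^\lambda_1(\mu)$, where $J_\lambda(x;1)=\sum_{\mu\vdash n}\theta^\lambda_1(\mu)p_\mu$ is the power sum expansion of the integral form Jack polynomial at $\alpha=1$ (the Schur function $s_\lambda$ multiplied by the product of the hook lengths of $\lambda$). Equivalently $\eta^\lambda_1=\frac{1}{\chi^\lambda(1)}\sum_{\pi\in D_n}\chi^\lambda(\pi)$, where $\chi^\lambda$ is the irreducible character of $S_n$ indexed by $\lambda$ and $D_n\subseteq S_n$ is the set of fixed-point-free permutations; this is the eigenvalue indexed by $\lambda$ of the permutation derangement graph $\Gamma_{n,1}$, the Cayley graph of $S_n$ generated by $D_n$. Frobenius coordinates: $d$ is the number of $i$ with $\lambda_i\ge i$, and $a_i=\lambda_i-i$, $b_i=\lambda'_i-i$ for $1\le i\le d$, where $\lambda'$ is the conjugate partition. $p_{m,k}=d_{m,k}/m!$, where $d_{m,k}$ is the number of permutations in $S_m$ with exactly $k$ fixed points. Extended hook products (here at $\alpha=1$). The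 complement $\lambda^c$ of $\lambda$ is the set of cells $(i,j)$ with $1\le i\le\ell$, $\lambda_i<j\le\lambda_1$. For $(i,j)\in\lambda$ the hook length is $(\lambda_i-j)+(\lambda'_j-i)+1$. For $(i,j)\in\lambda^c$ the hook length is the hook length of the corresponding cell in the partition obtained by rotating $\lambda^c$ by $180^\circ$; that is, it equals $(j-\lambda_i-1)+(i-1-\lambda'_j)+1$ (number of complement cells to the left in the row, plus number of complement cells above in the column, plus one). $H_i^+(\lambda)$ is the product of the hook lengths of all cells of $\lambda$ in row $i$ times the product of the hook lengths of all cells of $\lambda^c$ in row $i$ (empty products are $1$). *)

(* Defs.v *)
(* ClassicalEpsilon only serves to name the coefficients of an expansion. *)
From Stdlib Require Import ClassicalEpsilon.
From HB Require Import structures.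
From mathcomp Require Import all_boot all_order all_fingroup all_algebra.
From mathcomp Require Import mpoly.

Set Implicit Arguments.
Unset Strict Implicit.
Unset Printing Implicit Defensive.

Import Order.TTheory GRing.Theory Num.Theory.

Local Open Scope ring_scope.

(* A partition of n is the weakly decreasing sequence of its nonzero parts. *)
Definition is_partn (n : nat) (la : seq nat) : bool :=
  [&& sorted geq la, 0%N \notin la & sumn la == n].

(* All partitions of n, without repetition: a partition of n has at most n
   parts, each at most n, so nothing is lost by the bounds. *)
Definition partns (n : nat) : seq (seq nat) :=
  [seq s <- [seq map val mu | mu : {bseq n of 'I_n.+1}] | is_partn n s].

(* Rows and columns are numbered from 1, so row and column numbers below are
   meant to be positive; [part la i] is 0 when i exceeds the number of parts. *)
Definition part (la : seq nat) (i : nat) : nat := nth 0%N la i.-1.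

Definition conj_part (la : seq nat) (j : nat) : nat := count (leq j) la.

Definition durfee (la : seq nat) : nat :=
  count (fun i => i <= part la i)%N (iota 1 (size la)).

(* a_i for 1 <= i <= d, extended by the convention a_(d+1) = -1. *)
Definition frob_a (la : seq nat) (i : nat) : int :=
  if (i <= durfee la)%N then (part la i)%:Z - i%:Z else -1.

(* In both hook lengths the subtractions are exact on the relevant cells:
   j <= la_i (i.e. i <= la'_j) for a cell of the diagram, and la_i < j
   (i.e. la'_j < i) for a cell of the complement. *)
Definition hook (la : seq nat) (i j : nat) : nat :=
  ((part la i - j) + (conj_part la j - i) + 1)%N.

Definition cohook (la : seq nat) (i j : nat) : nat :=
  ((j - part la i - 1) + (i - 1 - conj_part la j) + 1)%N.

Definition hook_prod (la : seq nat) : nat :=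
  (\prod_(1 <= i < (size la).+1) \prod_(1 <= j < (part la i).+1)
     hook la i j)%N.

Definition ext_hook_prod (la : seq nat) (i : nat) : nat :=
  ((\prod_(1 <= j < (part la i).+1) hook la i j) *
   (\prod_((part la i).+1 <= j < (part la 1).+1) cohook la i j))%N.

(* k ranges over int because it is instantiated with a difference of
   Frobenius coordinates; the value is 0 when k < 0. *)
Definition num_fix (m : nat) (k : int) : nat :=
  #|[set s : 'S_m | #|[set x | s x == x]|%:Z == k]|.

Definition p_fix (m : nat) (k : int) : rat := (num_fix m k)%:R / (m`!)%:R.

Definition alternant (N : nat) (al : nat -> nat) : {mpoly rat[N]} :=
  \det (\matrix_(i < N, j < N) ('X_j ^+ al i : {mpoly rat[N]})).

(* The Schur function in N variables, for N at least the number of parts, as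
   the quotient of det(x_j ^ (la_i + N - i)) by the Vandermonde determinant
   det(x_j ^ (N - i)); here the row index i starts at 0. *)
Definition schur (N : nat) (la : seq nat) : {fraction {mpoly rat[N]}} :=
  tofrac (alternant N (fun i => nth 0 la i + (N - i.+1))%N)
  / tofrac (alternant N (fun i => N - i.+1)%N).

(* The integral form Jack polynomial at alpha = 1. *)
Definition jack1 (N : nat) (la : seq nat) : {fraction {mpoly rat[N]}} :=
  (hook_prod la)%:R * schur N la.

Definition power_sum (N : nat) (mu : seq nat) : {mpoly rat[N]} :=
  \prod_(k <- mu) \sum_(j < N) 'X_j ^+ k.

(* An identity between symmetric functions is an identity in every (large
   enough) finite number of variables. *)
Definition is_power_sum_expansion (n : nat) (la : seq nat)
    (th : seq nat -> rat) : Prop :=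
  forall N : nat, (size la <= N)%N ->
    jack1 N la = tofrac (\sum_(mu <- partns n) th mu *: power_sum N mu).

(* The coefficients theta^la_1(mu): the p_mu with mu a partition of n are
   linearly independent, so the values at partitions of n are determined;
   values elsewhere are irrelevant. *)
Definition theta1 (n : nat) (la : seq nat) : seq nat -> rat :=
  epsilon (inhabits (fun _ => 0)) (is_power_sum_expansion n la).

Definition eta1 (n : nat) (la : seq nat) : rat :=
  \sum_(mu <- partns n | 1%N \notin mu) theta1 n la mu.

(* Main.v *)
(* Let phi be the ring homomorphism from symmetric functions with p_1 -> 0 and
   p_k -> 1 for k >= 2, so that eta_1 = phi(J_la). Since
   sum_m h_m t^m = exp(sum_k p_k t^k / k), it sends h_m to
   d_m = sum_(k <= m) (-1)^k / k!, and by the Jacobi-Trudi identity eta_1 is the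
   hook product times det (d_(la_i - i + j)). As theta_1 is only known through
   finitely many variables, phi is realised by evaluation at complex numbers
   whose complete homogeneous functions h_m are the d_m.

   Subtracting neighbouring columns turns all columns but the first into
   (-1)^m / m!. In the expansion along the first column the minors become
   Vandermonde determinants, and row i contributes
   d_(la_i - i + 1) = (la_1 - la_i + i - 1)! p_(la_1, a_1 - a_i). The hook length
   formula, applied row by row to la and to its rotated complement, identifies
   the remaining factors with the extended hook products. *)
Require Import Defs.
From Stdlib Require Import ClassicalEpsilon.
From mathcomp Require Import all_boot all_order all_fingroup all_algebra all_field.
From mathcomp Require Import mpoly.
From mathcomp Require Import zify ring.

Set Implicit Arguments.
Unset Strict Implicit.
Unset Printing Implicit Defensive.

Import Order.TTheory GRing.Theory Num.Theory.
Local Open Scope ring_scope.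

(** * Complete homogeneous symmetric functions and the Jacobi-Trudi identity *)

Section CompleteHomogeneous.

Variable R : comNzRingType.
Implicit Types p q : {poly R}.

(** Power series are represented by polynomials modulo ['X^T]. *)
Definition eqmodXn T p q := forall m, (m < T)%N -> p`_m = q`_m.

Lemma eqmodXn_trans T p q r : eqmodXn T p q -> eqmodXn T q r -> eqmodXn T p r.
Proof. by move=> pq qr m mT; rewrite pq ?qr. Qed.

Lemma eqmodXn_mul T p p' q q' :
  eqmodXn T p p' -> eqmodXn T q q' -> eqmodXn T (p * q) (p' * q').
Proof.
move=> pp' qq' m mT; rewrite !coefM; apply: eq_bigr => j _.
by have := ltn_ord j => jm; rewrite pp' ?qq' //; lia.
Qed.

Lemma eqmodXn_prod T (I : finType) (P : pred I) (F G : I -> {poly R}) :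
  (forall i, P i -> eqmodXn T (F i) (G i)) ->
  eqmodXn T (\prod_(i | P i) F i) (\prod_(i | P i) G i).
Proof.
by move=> FG; apply: (big_ind2 (eqmodXn T)) => // *; apply: eqmodXn_mul.
Qed.

Lemma eqmodXn_prod1 T (I : finType) (P : pred I) (F : I -> {poly R}) :
  (forall i, P i -> eqmodXn T (F i) 1) -> eqmodXn T (\prod_(i | P i) F i) 1.
Proof.
move=> F1; apply: (big_ind (fun p => eqmodXn T p 1)) => // p q p1 q1.
by rewrite -[X in eqmodXn _ _ X]mulr1; apply: eqmodXn_mul.
Qed.

Definition geom_poly T (y : R) : {poly R} := \poly_(k < T) y ^+ k.

Lemma geom_polyK T y : eqmodXn T ((1 - y *: 'X) * geom_poly T y) 1.
Proof.
move=> m mT; rewrite mulrBl mul1r coefB -scalerAl coefZ coefXM coef1.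
rewrite !coef_poly mT; case: m mT => [|m] mT /=; first by rewrite mulr0 subr0.
by rewrite (ltnW mT) -exprS subrr.
Qed.

Section FixedVariables.

Variables (N : nat) (x : 'I_N -> R).

(* Geometric series truncated after degree m are enough for the coefficient
   of degree m. *)
Definition hsym m : R := (\prod_(i < N) geom_poly m.+1 (x i))`_m.

Definition psum k : R := \sum_(i < N) x i ^+ k.

Lemma hsym_geom T : eqmodXn T (\prod_(i < N) geom_poly T (x i))
  (\poly_(m < T) hsym m).
Proof.
move=> m mT; rewrite coef_poly mT /hsym.
apply: (@eqmodXn_prod m.+1) => // i _ k km.
by rewrite !coef_poly km (leq_trans km mT).
Qed.

Lemma hsym0 : hsym 0 = 1.
Proof.
rewrite /hsym (_ : \prod_(i < N) _ = 1) ?coef1 // big1 // => i _.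
by rewrite /geom_poly poly_def big_ord1 !expr0 scale1r.
Qed.

Lemma hsym_inv T :
  eqmodXn T (\prod_(i < N) (1 - x i *: 'X) * \poly_(m < T) hsym m) 1.
Proof.
apply: (@eqmodXn_trans _ _
  (\prod_(i < N) (1 - x i *: 'X) * \prod_(i < N) geom_poly T (x i))).
  by apply: eqmodXn_mul => // m mT; rewrite hsym_geom.
by rewrite -big_split /=; apply: eqmodXn_prod1 => i _; apply: geom_polyK.
Qed.

(** The coefficient of degree c is (-1)^c times the elementary symmetric function e_c of the
    variables other than [x j]. *)
Definition omit_poly j : {poly R} := \prod_(i < N | i != j) (1 - x i *: 'X).

Lemma hsym_omit T j :
  eqmodXn T (omit_poly j * \poly_(m < T) hsym m)
    (geom_poly T (x j)).
Proof.
apply: (@eqmodXn_trans _ _ (omit_poly j *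
   \prod_(i < N) geom_poly T (x i))).
  by apply: eqmodXn_mul => // m mT; rewrite hsym_geom.
rewrite /omit_poly (bigD1 j (P := xpredT)) //= mulrCA -big_split /=.
rewrite -[X in eqmodXn _ _ X]mulr1; apply: eqmodXn_mul => //.
by apply: eqmodXn_prod1 => i _; apply: geom_polyK.
Qed.

(** Coefficients of t H' = (sum_k p_k t^k) H, the logarithmic derivative of H = prod_i 1 / (1 - x_i
    t). *)
Lemma newton_hsym m :
  m%:R * hsym m = \sum_(k < m) psum k.+1 * hsym (m - k.+1).
Proof.
pose T := m.+1; pose G i := geom_poly T (x i).
pose P i := \poly_(k < T) (if k is k'.+1 then x i ^+ k else 0).
have derivG i : eqmodXn T ('X * (G i)^`()) (P i * G i).
  move=> k kT; rewrite coefXM coefM; case: k kT => [|k] kT.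
    by rewrite big_ord1 [(P i)`__]coef_poly kT mul0r.
  rewrite coef_deriv coef_poly kT big_ord_recl [(P i)`__]coef_poly /= mul0r add0r.
  rewrite (eq_bigr (fun=> x i ^+ k.+1)) ?sumr_const ?card_ord //.
  move=> j _; rewrite /bump /= !coef_poly add1n ltnS.
  rewrite !ifT; try by have := ltn_ord j; lia.
  by rewrite -exprD; congr (_ ^+ _); have := ltn_ord j; lia.
have derivH : eqmodXn T ('X * (\prod_(i < N) G i)^`())
    ((\sum_(i < N) P i) * \prod_(i < N) G i).
  elim: (index_enum _) => [|i s IHs].
    by rewrite !big_nil -polyC1 derivC mulr0 mul0r.
  rewrite !big_cons derivM; set H := \prod_(j <- s) _; set S := \sum_(j <- s) _.
  have -> : 'X * ((G i)^`() * H + G i * H^`()) =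
    ('X * (G i)^`()) * H + G i * ('X * H^`()) by ring.
  have -> : (P i + S) * (G i * H) = (P i * G i) * H + G i * (S * H) by ring.
  move=> k kT; rewrite coefD [in RHS]coefD; congr (_ + _).
    exact: (eqmodXn_mul (derivG i)).
  exact: (@eqmodXn_mul T (G i)).
have mT : (m < T)%N by [].
have := derivH m mT.
rewrite coefXM; case: m @T @G @P derivG derivH mT => [|m] T G P _ _ mT /=.
  by rewrite mul0r big_ord0.
rewrite coef_deriv (hsym_geom mT) coef_poly mT mulr_natl => ->.
rewrite coefM big_ord_recl coef_sum big1 ?mul0r ?add0r; last first.
  by move=> i _; rewrite coef_poly.
apply: eq_bigr => j _; rewrite lift0 coef_sum; congr (_ * _).
  apply: eq_bigr => i _; rewrite coef_poly ifT //.
  by have := ltn_ord j; lia.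
by rewrite hsym_geom ?coef_poly ?ifT //; have := ltn_ord j; lia.
Qed.

End FixedVariables.

(* [shift f a b] is [f (a - b)] with the convention that [f] vanishes at
   negative arguments. *)
Definition shift (f : nat -> R) (a b : nat) : R :=
  if (b <= a)%N then f (a - b)%N else 0.

Definition jtdet (f : nat -> R) (l : nat -> nat) (n : nat) : R :=
  \det (\matrix_(i < n, j < n) shift f (l i + j) i).

Definition monomdet N (x : 'I_N -> R) (al : nat -> nat) : R :=
  \det (\matrix_(i < N, j < N) x j ^+ al i).

Lemma size_omit_poly N (x : 'I_N -> R) (j : 'I_N) :
  (size (omit_poly x j) <= N)%N.
Proof.
have sz (P : pred 'I_N) :
    (size (\prod_(i < N | P i) (1 - x i *: 'X : {poly R}))%R <= #|P|.+1)%N.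
  rewrite -sum1_card; elim/big_rec2: _ => [|i k p _ IHp].
    by rewrite size_poly1.
  apply: leq_trans (size_polyMleq _ _) _.
  have : (size (1 - x i *: 'X : {poly R})%R <= 2)%N.
    apply: leq_trans (size_polyD _ _) _; rewrite size_polyN size_poly1.
    rewrite geq_max /=; apply: leq_trans (size_scale_leq _ _) _.
    by rewrite size_polyX.
  by move: IHp; lia.
apply: leq_trans (sz _) _; have := cardC1 j; rewrite card_ord.
by rewrite /predC1 => ->; have := ltn_ord j; lia.
Qed.

(** Degree [m] of [hsym_omit]; the sum stops at [N] because [omit_poly] has degree below [N]. *)
Lemma hsym_pow N (x : 'I_N -> R) (j : 'I_N) m :
  x j ^+ m = \sum_(c < N) shift (hsym x) m c *
    (omit_poly x j)`_c.
Proof.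
have /(_ m (ltnSn m)) := @hsym_omit _ x m.+1 j.
rewrite coef_poly ltnSn => <-; rewrite coefM.
set p := omit_poly x j.
have widen M (F : nat -> R) : (M <= maxn N m.+1)%N ->
    \sum_(c < M) F c = \sum_(c < maxn N m.+1) (if (c < M)%N then F c else 0).
  by move=> leM; rewrite (big_ord_widen _ F leM) big_mkcond.
rewrite (widen m.+1 (fun c => p`_c * (\poly_(k < m.+1) hsym x k)`_(m - c)))
  ?leq_maxr //.
rewrite (widen N (fun c => shift (hsym x) m c * p`_c)) ?leq_maxl //.
apply: eq_bigr => c _; rewrite ltnS /shift.
have [cm|mc] := leqP c m; have [cN|Nc] := ltnP c N.
- rewrite mulrC; congr (_ * _).
  by rewrite coef_poly ifT // ltnS leq_subr.
- by rewrite [p`_c]nth_default ?mul0r //; apply: leq_trans (size_omit_poly x j) _.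
- by rewrite mul0r.
- by [].
Qed.

(* By [hsym_pow] the matrix of powers is the matrix of the h's times a matrix M
   that does not depend on l; for l = 0 the former is unitriangular, which gives
   det M. *)
Lemma jacobi_trudi_square N (x : 'I_N -> R) (l : nat -> nat) :
  monomdet x (fun i => l i + (N - i.+1))%N =
  jtdet (hsym x) l N * monomdet x (fun i => N - i.+1)%N.
Proof.
pose M := \matrix_(k < N, j < N)
  (omit_poly x j)`_(N - k.+1).
have factor l' : monomdet x (fun i => l' i + (N - i.+1))%N =
    jtdet (hsym x) l' N * \det M.
  rewrite /monomdet /jtdet -det_mulmx; congr (\det _).
  apply/matrixP => i j; rewrite !mxE hsym_pow.
  rewrite (reindex_inj rev_ord_inj) /=; apply: eq_bigr => k _.
  rewrite !mxE; congr (_ * _); rewrite /shift.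
  have iN := ltn_ord i; have kN := ltn_ord k.
  have -> : (N - k.+1 <= l' i + (N - i.+1))%N = (i <= l' i + k)%N by lia.
  by case: ifP => // ik; congr (hsym x _); lia.
have -> : monomdet x (fun i => N - i.+1)%N =
    jtdet (hsym x) (fun=> 0%N) N * \det M by rewrite -factor.
rewrite factor; congr (_ * _); rewrite /jtdet -[LHS]mul1r; congr (_ * _).
rewrite -det_tr det_trig.
  rewrite big1 // => i _; rewrite !mxE /shift leqnn subnn; exact: hsym0.
by apply/is_trig_mxP => i j ij; rewrite !mxE /shift leqNgt add0n ij.
Qed.

(** Rows from [n] on have [f 0 = 1] on the diagonal and zeros to its left, so the padded matrix is
    block triangular with a unitriangular last block. *)
Lemma jtdet_pad (f : nat -> R) (l : nat -> nat) n N :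
    f 0%N = 1 -> (n <= N)%N -> (forall i, (n <= i)%N -> l i = 0%N) ->
  jtdet f l N = jtdet f l n.
Proof.
move=> f0 nN l0; rewrite -(subnKC nN) /jtdet.
set A := \matrix_(_, _) _; rewrite -(submxK A).
have -> : dlsubmx A = 0.
  apply/matrixP => i j; rewrite !mxE /= /shift l0 ?leq_addr // leqNgt ifN //.
  by rewrite negbK; have := ltn_ord j; lia.
rewrite det_ublock [X in _ * X](_ : _ = 1).
  by rewrite mulr1; congr (\det _); apply/matrixP => i j; rewrite !mxE.
rewrite -det_tr det_trig.
  by rewrite big1 // => i _; rewrite !mxE /= /shift l0 ?leq_addr // leqnn subnn.
apply/is_trig_mxP => i j ij; rewrite !mxE /= /shift l0 ?leq_addr //.
by rewrite ifN // -ltnNge add0n ltn_add2l.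
Qed.

Lemma jacobi_trudi N (x : 'I_N -> R) (l : nat -> nat) n :
    (n <= N)%N -> (forall i, (n <= i)%N -> l i = 0%N) ->
  monomdet x (fun i => l i + (N - i.+1))%N =
  jtdet (hsym x) l n * monomdet x (fun i => N - i.+1)%N.
Proof.
by move=> nN l0; rewrite jacobi_trudi_square (jtdet_pad _ nN) ?hsym0.
Qed.

End CompleteHomogeneous.

(** * Vandermonde determinants *)

Section Vandermonde.

Variable R : comNzRingType.

Lemma det_rev n (A : 'M[R]_n) :
  \det (\matrix_(i < n, j < n) A (rev_ord i) (rev_ord j)) = \det A.
Proof.
pose s := perm (@rev_ord_inj n).
have -> : \matrix_(i < n, j < n) A (rev_ord i) (rev_ord j) =
    row_perm s (col_perm s A).
  by apply/matrixP => i j; rewrite !mxE !permE.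
rewrite row_permE col_permE !det_mulmx !det_perm odd_permV.
by rewrite mulrCA -signr_addb addbb mulr1.
Qed.

(** A unitriangular column operation reduces monic polynomials to pure powers. Degrees decrease
    along the columns, hence the factors y_i - y_j for i < j. *)
Lemma det_monic_poly n (p : nat -> {poly R}) (y : 'I_n -> R) :
    (forall c, p c \is monic) -> (forall c, size (p c) = c.+1) ->
  \det (\matrix_(i < n, j < n) (p (n - j.+1)%N).[y i]) =
  \prod_(i < n) \prod_(j < n | (i < j)%N) (y i - y j).
Proof.
move=> pmon psz.
have -> : \prod_(i < n) \prod_(j < n | (i < j)%N) (y i - y j) =
    \det (\matrix_(i < n, j < n) y i ^+ (n - j.+1)%N).
  rewrite -det_tr -det_rev.
  have -> : \matrix_(i < n, j < n)
      (\matrix_(i0, j0) y i0 ^+ (n - j0.+1)%N)^T (rev_ord i) (rev_ord j) =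
      Vandermonde n (\row_j y (rev_ord j)).
    apply/matrixP => i j; rewrite !mxE /=; congr (_ ^+ _).
    by have := ltn_ord i; lia.
  rewrite det_Vandermonde.
  rewrite [LHS]pair_big_dep [RHS]pair_big_dep /=.
  rewrite (reindex_inj (h := fun ij : 'I_n * 'I_n => (rev_ord ij.2, rev_ord ij.1))).
    apply: eq_big => [[i j] | [i j] _] /=; last by rewrite !mxE.
    by have := ltn_ord i; have := ltn_ord j; lia.
  apply: (can_inj (g := fun ij => (rev_ord ij.2, rev_ord ij.1)))
    => -[i j]; by rewrite /= !rev_ordK.
pose T := \matrix_(k < n, j < n) (p (n - j.+1)%N)`_(n - k.+1).
have detT : \det T = 1.
  rewrite det_trig.
    rewrite big1 // => i _; rewrite !mxE; have /eqP := pmon (n - i.+1)%N.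
    by rewrite lead_coefE psz.
  apply/is_trig_mxP => i j ij; rewrite !mxE nth_default // psz.
  by have := ltn_ord j; lia.
rewrite -[RHS]mulr1 -detT -det_mulmx; congr (\det _); apply/matrixP => i j.
rewrite !mxE (@horner_coef_wide _ n); last first.
  by rewrite psz; have := ltn_ord j; lia.
rewrite (reindex_inj rev_ord_inj) /=; apply: eq_bigr => k _.
by rewrite !mxE mulrC.
Qed.

Lemma monomdet_delta n (x : 'I_n -> R) :
  monomdet x (fun i => n - i.+1)%N =
  \prod_(i < n) \prod_(j < n | (i < j)%N) (x i - x j).
Proof.
rewrite -(@det_monic_poly _ (fun c => 'X^c)); last 2 first.
- by move=> c; apply: monicXn.
- by move=> c; rewrite size_polyXn.
rewrite /monomdet -det_tr; congr (\det _); apply/matrixP => i j.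
by rewrite !mxE hornerXn.
Qed.

End Vandermonde.

Section Morphisms.

Variables (R S : comNzRingType) (f : {rmorphism R -> S}).

Lemma map_geom_poly T y : map_poly f (geom_poly T y) = geom_poly T (f y).
Proof.
apply/polyP => k; rewrite coef_map !coef_poly; case: ifP => _ /=.
  by rewrite rmorphXn.
by rewrite rmorph0.
Qed.

Lemma rmorph_hsym N (x : 'I_N -> R) m : f (hsym x m) = hsym (f \o x) m.
Proof.
rewrite /hsym -coef_map rmorph_prod /=.
by under eq_bigr => i _ do rewrite map_geom_poly.
Qed.

Lemma rmorph_jtdet (h : nat -> R) l n : f (jtdet h l n) = jtdet (f \o h) l n.
Proof.
rewrite /jtdet -det_map_mx; congr (\det _); apply/matrixP => i j.
by rewrite !mxE /shift; case: ifP => // _; rewrite rmorph0.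
Qed.

End Morphisms.

Lemma eq_jtdet (R : comNzRingType) (h h' : nat -> R) (l : nat -> nat) n :
    (forall i j k, (i < n)%N -> (j < n)%N -> (k <= l i + j)%N -> h k = h' k) ->
  jtdet h l n = jtdet h' l n.
Proof.
move=> hh'; congr (\det _); apply/matrixP => i j; rewrite !mxE /shift.
by case: ifP => // _; apply: (hh' i j) => //; apply: leq_subr.
Qed.

(** * The power sum expansion *)

(* The coefficients do not depend on the number N of variables. *)
Definition psum_comb (n : nat) (f : forall N, {mpoly rat[N]}) : Prop :=
  exists s : seq (rat * seq nat),
    all (fun c => (sumn c.2 == n) && (0%N \notin c.2)) s /\
    forall N, f N = \sum_(c <- s) c.1 *: power_sum N c.2.

Lemma psum_comb_eq n (f g : forall N, {mpoly rat[N]}) :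
  (forall N, f N = g N) -> psum_comb n f -> psum_comb n g.
Proof. by move=> fg [s [sn fs]]; exists s; split=> // N; rewrite -fg. Qed.

Lemma psum_comb0 n : psum_comb n (fun N => 0).
Proof. by exists [::]; split=> // N; rewrite big_nil. Qed.

Lemma psum_combD n f g : psum_comb n f -> psum_comb n g ->
  psum_comb n (fun N => f N + g N).
Proof.
move=> [s [sn fs]] [t [tn gt]]; exists (s ++ t); rewrite all_cat sn tn.
by split=> // N; rewrite fs gt big_cat.
Qed.

Lemma psum_combZ n a f : psum_comb n f -> psum_comb n (fun N => a *: f N).
Proof.
move=> [s [/allP sn fs]]; exists [seq (a * c.1, c.2) | c <- s]; split.
  by apply/allP => _ /mapP[c cs ->]; have := sn _ cs.
move=> N; rewrite fs scaler_sumr big_map.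
by apply: eq_bigr => c _; rewrite scalerA.
Qed.

Lemma psum_comb1 : psum_comb 0 (fun N => 1).
Proof.
exists [:: (1, [::])]; split=> // N.
by rewrite big_seq1 /power_sum big_nil scale1r.
Qed.

Lemma psum_combM m n f g : psum_comb m f -> psum_comb n g ->
  psum_comb (m + n) (fun N => f N * g N).
Proof.
move=> [s [/allP sm fs]] [t [/allP tn gt]].
exists [seq (c.1 * e.1, c.2 ++ e.2) | c <- s, e <- t]; split.
  apply/allP => z /allpairsPdep[c [e [cs et ->]]].
  have /= /andP[/eqP cm c0] := sm _ cs; have /= /andP[/eqP en e0] := tn _ et.
  by rewrite /= sumn_cat cm en eqxx mem_cat (negPf c0) (negPf e0).
move=> N; rewrite fs gt big_allpairs_dep mulr_suml; apply: eq_bigr => c _.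
rewrite mulr_sumr; apply: eq_bigr => e _ /=.
by rewrite /power_sum big_cat /= -scalerAl -scalerAr scalerA.
Qed.

Lemma psum_comb_sum n (I : Type) (r : seq I) (F : I -> forall N, {mpoly rat[N]}) :
  (forall i, psum_comb n (F i)) -> psum_comb n (fun N => \sum_(i <- r) F i N).
Proof.
move=> Fn; elim: r => [|i r IHr].
  by apply: psum_comb_eq (psum_comb0 n) => N; rewrite big_nil.
by apply: psum_comb_eq (psum_combD (Fn i) IHr) => N; rewrite big_cons.
Qed.

Lemma psum_comb_prod (I : Type) (r : seq I) (d : I -> nat)
    (F : I -> forall N, {mpoly rat[N]}) :
  (forall i, psum_comb (d i) (F i)) ->
  psum_comb (\sum_(i <- r) d i) (fun N => \prod_(i <- r) F i N).
Proof.
move=> Fn; elim: r => [|i r IHr].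
  by rewrite big_nil; apply: psum_comb_eq psum_comb1 => N; rewrite big_nil.
rewrite big_cons.
by apply: psum_comb_eq (psum_combM (Fn i) IHr) => N; rewrite big_cons.
Qed.

Definition mvars N : 'I_N -> {mpoly rat[N]} := fun i => 'X_i.

(** Strong induction on Newton's identity, divided by the degree, which is possible over the
    rationals. *)
Lemma psum_comb_hsym m : psum_comb m (fun N => hsym (@mvars N) m).
Proof.
elim/ltn_ind: m => -[_|m IHm].
  by apply: psum_comb_eq psum_comb1 => N; rewrite hsym0.
apply: (@psum_comb_eq _ (fun N => m.+1%:R^-1 *:
    \sum_(k < m.+1) psum (@mvars N) k.+1 * hsym (@mvars N) (m.+1 - k.+1))).
  move=> N; rewrite -newton_hsym mulr_natl -scaler_nat scalerA mulVf ?scale1r //.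
  by rewrite pnatr_eq0.
apply: psum_combZ; apply: psum_comb_sum => k.
have pk : psum_comb k.+1 (fun N => psum (@mvars N) k.+1).
  exists [:: (1, [:: k.+1])]; split; first by rewrite /= addn0 eqxx.
  by move=> N; rewrite big_seq1 scale1r /power_sum big_seq1.
have hk : psum_comb (m.+1 - k.+1) (fun N => hsym (@mvars N) (m.+1 - k.+1)).
  by apply: IHm; rewrite ltnS subSS leq_subr.
by have := psum_combM pk hk; rewrite subnKC.
Qed.

(** In the Leibniz expansion, a term without negative index is a product of h's whose degrees l_i +
    s(i) - i add up to the sum of the l_i, since [s] permutes the indices. *)
Lemma psum_comb_jtdet (l : nat -> nat) n :
  psum_comb (\sum_(i < n) l i) (fun N => jtdet (hsym (@mvars N)) l n).
Proof.
rewrite /jtdet /determinant; apply: psum_comb_sum => s.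
apply: (@psum_comb_eq _ (fun N => ((-1) ^+ s : rat) *:
   \prod_(i < n) shift (hsym (@mvars N)) (l i + s i) i)).
  move=> N; rewrite -mul_mpolyC rmorphXn rmorphN1; congr (_ * _).
  by apply: eq_bigr => i _; rewrite mxE.
apply: psum_combZ.
have [/forallP le_s|] := boolP [forall i : 'I_n, i <= l i + s i]%N; last first.
  case/forallPn => i lt_i; apply: psum_comb_eq (psum_comb0 _) => N.
  by rewrite (bigD1 i) //= /shift (negPf lt_i) mul0r.
have -> : (\sum_(i < n) l i = \sum_(i < n) (l i + s i - i))%N.
  apply/eqP; rewrite -(eqn_add2r (\sum_(i < n) i)).
  have {1}-> : (\sum_(i < n) i = \sum_(i < n) s i)%N.
    by rewrite (reindex_inj (@perm_inj _ s)).
  rewrite -!big_split /=; apply/eqP; apply: eq_bigr => i _.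
  by rewrite subnK.
apply: psum_comb_prod => i.
apply: psum_comb_eq (psum_comb_hsym _) => N.
by rewrite /shift le_s.
Qed.

Lemma partns_uniq n : uniq (partns n).
Proof.
rewrite filter_uniq // map_inj_uniq ?enum_uniq // => s t.
by move=> /(inj_map val_inj)/val_inj.
Qed.

Lemma mem_partns n s : (s \in partns n) = is_partn n s.
Proof.
rewrite mem_filter andb_idr // => /and3P[_ s0 /eqP sn].
have le_sn i : i \in s -> (i <= n)%N.
  by move=> /perm_to_rem/perm_sumn; rewrite -sn /= => ->; apply: leq_addr.
have sz : (size (map inord s : seq 'I_n.+1) <= n)%N.
  rewrite size_map -sn; elim: (s) s0 => //= i t IHt.
  by rewrite inE negb_or => /andP[i0 /IHt]; lia.
apply/mapP; exists (Bseq sz); first by rewrite mem_enum.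
rewrite -map_comp -[LHS]map_id; apply/eq_in_map => i /le_sn le_i.
by rewrite /= inordK.
Qed.

Lemma psum_comb_partns n f : psum_comb n f ->
  exists th, forall N, f N = \sum_(mu <- partns n) th mu *: power_sum N mu.
Proof.
move=> [s [/allP sn fs]].
(* Products that differ only by the order of their factors are merged under their sorted form. *)
exists (fun mu => \sum_(c <- s | sort geq c.2 == mu) c.1) => N.
under eq_bigr => mu _ do rewrite scaler_suml big_mkcond.
rewrite fs exchange_big /= big_seq [RHS]big_seq; apply: eq_bigr => c cs.
have /andP[/eqP cn c0] := sn _ cs.
have cp : sort geq c.2 \in partns n.
  rewrite mem_partns /is_partn mem_sort c0 (perm_sumn (s2 := c.2)) ?perm_sort //.
  rewrite cn eqxx sort_sorted // => a b; exact: leq_total.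
rewrite (bigD1_seq _ cp (partns_uniq n)) /= eqxx big1 ?addr0.
  by congr (_ *: _); apply: perm_big; rewrite perm_sym perm_sort.
by move=> mu; rewrite eq_sym => /negPf->.
Qed.

Lemma alternant_delta_neq0 N : alternant N (fun i => N - i.+1)%N != 0.
Proof.
have -> : alternant N (fun i => N - i.+1)%N =
  monomdet (@mvars N) (fun i => N - i.+1)%N by [].
rewrite monomdet_delta; apply/prodf_neq0 => i _; apply/prodf_neq0 => j ij.
rewrite subr_eq0; apply/eqP => /(congr1 (mcoeff U_(i)%MM)).
rewrite !mcoeffXU eqxx -val_eqE /= (gtn_eqF ij) => /eqP.
by rewrite oner_eq0.
Qed.

Lemma sumn_nth la : sumn la = (\sum_(i < size la) nth 0 la i)%N.
Proof. by rewrite sumnE (big_nth 0%N) big_mkord. Qed.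

Lemma jack1_jtdet N la : (size la <= N)%N ->
  jack1 N la =
  tofrac ((hook_prod la)%:R * jtdet (hsym (@mvars N)) (nth 0%N la) (size la)).
Proof.
move=> leN; rewrite /jack1 /schur rmorphM rmorph_nat; congr (_ * _).
have -> : alternant N (fun i => nth 0 la i + (N - i.+1))%N =
    jtdet (hsym (@mvars N)) (nth 0%N la) (size la) *
    alternant N (fun i => N - i.+1)%N.
  by apply: jacobi_trudi => // i; apply: nth_default.
by rewrite rmorphM mulfK // tofrac_eq0 alternant_delta_neq0.
Qed.

(** The Jacobi-Trudi determinant provides an expansion with coefficients independent of [N], so the
    choice made by [epsilon] is one. *)
Lemma theta1P n la : is_partn n la -> is_power_sum_expansion n la (theta1 n la).
Proof.
move=> /and3P[_ _ /eqP lan]; apply: epsilon_spec.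
have := psum_comb_jtdet (nth 0%N la) (size la); rewrite -sumn_nth lan.
move=> /(psum_combZ (hook_prod la)%:R)/psum_comb_partns[th thE].
exists th => N leN; rewrite jack1_jtdet // -thE.
by rewrite scaler_nat mulr_natl.
Qed.

(** * Permutations by number of fixed points *)

(** Double counting: a given [j]-set is fixed pointwise by (m - j)! permutations. *)
Lemma sum_bin_fixpoints m j : (j <= m)%N ->
  ((\sum_(s : 'S_m) 'C(#|[set x | s x == x]|, j)) * j`! = m`!)%N.
Proof.
move=> jm; under eq_bigr => s _ do rewrite -cards_draws -sum1dep_card.
rewrite (exchange_big_dep (fun B : {set 'I_m} => #|B| == j)) /=; last first.
  by move=> s B _ /andP[].
rewrite (eq_bigr (fun=> (m - j)`!)) => [|B /eqP Bj].
  rewrite sum_nat_const -[#|_|]/(#|[pred B : {set 'I_m} | #|B| == j]|).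
  have -> : #|[pred B : {set 'I_m} | #|B| == j]| = 'C(m, j).
    by have := card_draws 'I_m j; rewrite card_ord cardsE.
  by rewrite -mulnA [((m - j)`! * _)%N]mulnC bin_fact.
have -> : (m - j)%N = #|~: B| by rewrite cardsCs setCK card_ord Bj.
rewrite -card_perm sum1dep_card -cardsE; apply: eq_card => s; rewrite !inE Bj eqxx andbT.
apply/subsetP/subsetP => [fixB x | permB x xB]; rewrite !inE.
  by apply: contra => /fixB; rewrite inE.
by apply: contraLR xB => sx; have := permB x; rewrite !inE => /(_ sx).
Qed.

Lemma sum_alternating_bin n M : (n < M)%N ->
  \sum_(i < M) (-1) ^+ i * 'C(n, i)%:R = (n == 0%N)%:R :> rat.
Proof.
move=> nM; have := exprBn (1 : rat) 1 n; rewrite subrr expr0n => ->.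
rewrite (big_ord_widen_cond _ xpredT
  (fun i : nat => ((-1) ^+ i * 1 ^+ (n - i) * 1 ^+ i) *+ 'C(n, i)) nM).
rewrite [RHS]big_mkcond; apply: eq_bigr => i _ /=.
rewrite !expr1n !mulr1 ltnS mulr_natr; case: leqP => // ni.
by rewrite bin_small.
Qed.

Lemma bin_mul_sub f k i : ('C(k + i, k) * 'C(f, k + i) = 'C(f, k) * 'C(f - k, i))%N.
Proof.
have [le_f|lt_f] := leqP (k + i) f; last first.
  rewrite (bin_small lt_f) muln0; have [kf|fk] := leqP k f.
    by rewrite (@bin_small (f - k)) ?muln0 //; lia.
  by rewrite bin_small.
have e1 := @bin_fact (k + i) k (leq_addr _ _).
have e2 := bin_fact le_f; have e3 := @bin_fact f k (leq_trans (leq_addr _ _) le_f).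
have le_i : (i <= f - k)%N by lia.
have e4 := bin_fact le_i; rewrite -subnDA in e4; rewrite addKn in e1.
have := fact_gt0 k; have := fact_gt0 i; have := fact_gt0 (f - (k + i)).
move=> p1 p2 p3; apply/eqP.
rewrite -(@eqn_pmul2r (k`! * i`! * (f - (k + i))`!)) ?muln_gt0 ?p1 ?p2 ?p3 //.
apply/eqP.
transitivity ('C(f, k + i) *
  (('C(k + i, k) * (k`! * i`!)) * (f - (k + i))`!))%N; first by ring.
rewrite e1 e2 -e3 -e4; ring.
Qed.

(* The coefficients of exp(-t) / (1 - t). *)
Definition dser (m : nat) : rat := \sum_(k < m.+1) (-1) ^+ k / k`!%:R.

Lemma p_fixE m k : (k <= m)%N -> p_fix m k%:Z = dser (m - k) / k`!%:R.
Proof.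
move=> km; rewrite /p_fix /num_fix -sum1dep_card natr_sum /=.
(* Inclusion-exclusion for one permutation: the indicator of exactly [k] fixed points is an
   alternating sum of binomials in their number. *)
rewrite big_mkcond (eq_bigr (fun s : 'S_m => \sum_(i < (m - k).+1)
   (-1) ^+ i * ('C(k + i, k) * 'C(#|[set x | s x == x]|, k + i))%:R)); last first.
  move=> s _; set f := #|_|; under eq_bigr => i _ do rewrite bin_mul_sub natrM mulrCA.
  have fm : (f <= m)%N by rewrite -[m in (_ <= m)%N]card_ord max_card.
  rewrite -mulr_sumr sum_alternating_bin; last by lia.
  rewrite eqz_nat; have [->|nfk] := eqVneq f k.
    by rewrite subnn binn mulr1.
  have [lt_fk|le_kf] := ltnP f k; first by rewrite bin_small ?mul0r.
  by rewrite (_ : _ == 0%N = false) ?mulr0 //; lia.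
rewrite exchange_big /= /dser !mulr_suml; apply: eq_bigr => i _.
have kim : (k + i <= m)%N by have := ltn_ord i; lia.
have nz a : a`!%:R != 0 :> rat by rewrite pnatr_eq0 -lt0n fact_gt0.
rewrite -mulr_sumr -natr_sum -big_distrr /= natrM.
have /(congr1 (fun a => a%:R : rat)) := sum_bin_fixpoints kim.
rewrite natrM => /(canRL (mulfK (nz _))) ->.
have /(congr1 (fun a => a%:R : rat)) := @bin_fact (k + i) k (leq_addr _ _).
rewrite addKn !natrM => /(canRL (mulfK (mulf_neq0 (nz _) (nz _)))) ->.
by field; rewrite !nz.
Qed.

(** * Evaluation of the power sums *)

(** Each root z contributes -z (1 - z^-1 'X). These constants and the leading coefficient multiply
    to [Q.[0]], whose value 1 also excludes the root 0. *)
Lemma prod_XsubC_1subX (F : fieldType) (r : seq F) (Q : {poly F}) :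
    Q.[0] = 1 -> Q = lead_coef Q *: \prod_(z <- r) ('X - z%:P) ->
  Q = \prod_(y <- map GRing.inv r) (1 - y *: 'X).
Proof.
move=> Q0 Qr; pose c := lead_coef Q * \prod_(z <- r) (- z).
have c1 : c = 1.
  move: Q0; rewrite Qr hornerZ horner_prod => <-; congr (_ * _).
  by apply: eq_bigr => z _; rewrite !hornerE.
have r0 z : z \in r -> z != 0.
  move=> zr; apply/eqP => z0; move: c1; rewrite /c (big_rem z) //= z0.
  by move/eqP; rewrite oppr0 mul0r mulr0 eq_sym oner_eq0.
rewrite {1}Qr -[RHS]scale1r -c1 /c -scalerA; congr (_ *: _).
rewrite big_map -scaler_prod big_seq [RHS]big_seq; apply: eq_bigr => z zr.
rewrite scalerBr scalerA mulNr divff ?r0 // scaleN1r opprK -mul_polyC mulr1.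
by rewrite polyCN addrC.
Qed.

(* Choose the x_i such that prod_i (1 - x_i t) is a truncation of the inverse of
   the series sum_m d_m t^m. *)
Lemma prescribed_hsym (F : closedFieldType) (d : nat -> F) (T l : nat) :
    d 0%N = 1 ->
  exists N (x : 'I_N -> F), (l <= N)%N /\
    forall m, (m < T)%N -> hsym x m = d m.
Proof.
move=> d0; pose D := \poly_(k < T.+1) d k.
(* A truncated geometric series for the inverse of [D]; it works because 1 - D has constant term
   0. *)
pose Q : {poly F} := \sum_(i < T.+1) (1 - D) ^+ i.
have QD : eqmodXn T.+1 (Q * D) 1.
  have -> : Q * D = 1 - (1 - D) ^+ T.+1.
    have := subrX1 (1 - D) T.+1; rewrite -/Q => E.
    have -> : Q * D = - ((1 - D - 1) * Q) by ring.
    by rewrite -E opprB.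
  have -> : 1 - D = - (\poly_(k < T) d k.+1) * 'X.
    apply/polyP => -[|k]; rewrite coefMX coefB coef1 coef_poly /=.
      by rewrite d0 subrr.
    by rewrite coefN coef_poly sub0r ltnS.
  by move=> m mT; rewrite exprMn coefB coefMXn mT subr0.
have Q0 : Q.[0] = 1.
  have := QD 0%N isT; rewrite coef0M coef_poly /= d0 mulr1 coef1 /=.
  by rewrite horner_coef0.
have [r Qr] := closed_field_poly_normal Q.
(* The zeros raise the number of variables to at least [l] and leave the product unchanged. *)
pose s := map GRing.inv r ++ nseq l 0.
exists (size s), (tnth (in_tuple s)); split.
  by rewrite /s size_cat size_nseq leq_addl.
have Qs : Q = \prod_(i < size s) (1 - tnth (in_tuple s) i *: 'X).
  rewrite (prod_XsubC_1subX Q0 Qr) -(big_tnth _ _ s xpredT (fun y => 1 - y *: 'X)).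
  rewrite big_cat /= [X in _ * X]big1_seq ?mulr1 // => y /andP[_].
  by move/nseqP => [-> _]; rewrite scale0r subr0.
have := @hsym_inv F _ (tnth (in_tuple s)) T.+1; rewrite -Qs => QH.
move=> m mT; set H := \poly_(_ < _) _ in QH.
have -> : hsym (tnth (in_tuple s)) m = (H * 1)`_m.
  by rewrite mulr1 coef_poly ltnS ltnW.
have -> : d m = (D * 1)`_m by rewrite mulr1 coef_poly ltnS ltnW.
have mT1 : (m < T.+1)%N by rewrite ltnS ltnW.
rewrite -(eqmodXn_mul (fun _ _ => erefl) QD mT1).
rewrite -(eqmodXn_mul (fun _ _ => erefl) QH mT1).
by have -> : H * (Q * D) = D * (Q * H) by ring.
Qed.

Lemma dser0 : dser 0 = 1.
Proof. by rewrite /dser big_ord1 expr0 divr1. Qed.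

Lemma dserS m : dser m.+1 = dser m + (-1) ^+ m.+1 / m.+1`!%:R.
Proof. by rewrite /dser big_ord_recr. Qed.

(** Newton's identity for p_1 = 0 and p_k = 1 when k >= 2, that is t D' = t^2 / (1 - t) D for D =
    exp(-t) / (1 - t); the index [k] stands for p_(k+1). *)
Lemma dser_newton m :
  m%:R * dser m = \sum_(k < m) (0 < k)%:R * dser (m - k.+1).
Proof.
case: m => [|m]; first by rewrite mul0r big_ord0.
rewrite big_ord_recl mul0r add0r.
transitivity (\sum_(k < m) dser k); last first.
  rewrite (reindex_inj rev_ord_inj); apply: eq_bigr => k _ /=.
  by rewrite mul1r; congr (dser _); rewrite /bump /=; lia.
elim: m => [|m IHm].
  by rewrite big_ord0 mul1r dserS dser0 expr1 divr1 subrr.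
rewrite big_ord_recr -IHm /= dserS [m.+2%:R]mulrS mulrDl mul1r mulrDr.
rewrite dserS !factS !natrM !exprS.
have m1 : m.+1%:R != 0 :> rat by rewrite pnatr_eq0.
have m2 : m.+2%:R != 0 :> rat by rewrite pnatr_eq0.
have mf : m`!%:R != 0 :> rat by rewrite pnatr_eq0 -lt0n fact_gt0.
by field; rewrite mf -mulrS m1 -natrD m2.
Qed.

(** Since h_0 = 1, Newton's identities determine the power sums from the h's; they are compared with
    [dser_newton]. *)
Lemma psum_of_hsym (F : numFieldType) N (x : 'I_N -> F) T :
    (forall m, (m < T)%N -> hsym x m = ratr (dser m)) ->
  forall k, (k.+1 < T)%N -> psum x k.+1 = (0 < k)%:R.
Proof.
move=> xd; elim/ltn_ind => k IHk kT.
have := newton_hsym x k.+1; rewrite big_ord_recr /= subnn hsym0 mulr1 xd //.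
have /(congr1 (@ratr F)) := dser_newton k.+1.
rewrite rmorphM rmorph_nat => -> /eqP.
rewrite big_ord_recr /= subnn dser0 mulr1 rmorphD rmorph_sum rmorph_nat /=.
rewrite [X in _ == X + _](_ : _ = \sum_(i < k) ratr ((0 < i)%:R * dser (k.+1 - i.+1))).
  by rewrite (inj_eq (addrI _)) => /eqP.
apply: eq_bigr => i _; have ik := ltn_ord i.
by rewrite IHk ?xd ?rmorphM ?rmorph_nat //; lia.
Qed.

Lemma eq_hsym (R : comNzRingType) N (x y : 'I_N -> R) m :
  x =1 y -> hsym x m = hsym y m.
Proof. by move=> xy; rewrite /hsym; under eq_bigr => i _ do rewrite xy. Qed.

(** At the chosen points p_mu is 0 if [mu] has a part 1 and 1 otherwise, so the expansion of
    [theta1P] collapses to [eta1]. *)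
Lemma eta1_jtdet n la : is_partn n la ->
  eta1 n la = (hook_prod la)%:R * jtdet dser (nth 0%N la) (size la).
Proof.
(* Degrees below [T] cover the h's of the determinant (at most n + n) and the power sums (at most
   n). *)
move=> lan; pose T := (n + n).+2.
have [N [x [leN xd]]] := @prescribed_hsym algC (ratr \o dser) T (size la)
  (etrans (congr1 _ dser0) (rmorph1 _)).
have px := psum_of_hsym xd.
have /(_ N leN)/eqP := theta1P lan.
rewrite jack1_jtdet // tofrac_eq => /eqP/(congr1 (mmap (@ratr algC) x)).
have xE : mmap (@ratr algC) x \o @mvars N =1 x.
  by move=> i; rewrite /= mmapX mmap1U.
have le_sumn s i : i \in s -> (i <= sumn s)%N.
  by move=> /perm_to_rem/perm_sumn ->; apply: leq_addr.
have /and3P[_ la0 /eqP lan_n] := lan.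
have leq_size : (size la <= n)%N.
  by rewrite -lan_n; elim: (la) la0 => //= i t IHt;
    rewrite inE negb_or => /andP[i0 /IHt]; lia.
rewrite rmorphM rmorph_nat rmorph_jtdet.
rewrite (@eq_jtdet _ _ (ratr \o dser)); last first.
  move=> i j k il jl kle /=; rewrite rmorph_hsym (eq_hsym _ xE) xd //.
  have : (nth 0 la i <= n)%N by rewrite -lan_n le_sumn // mem_nth.
  by rewrite /T; lia.
have -> : jtdet (ratr \o dser) (nth 0%N la) (size la) =
    ratr (jtdet dser (nth 0%N la) (size la)) :> algC by rewrite rmorph_jtdet.
rewrite -[X in X * _ = _](rmorph_nat (@ratr algC)) -rmorphM => E.
apply: (fmorph_inj (@ratr algC)); rewrite {}E /eta1 !rmorph_sum big_mkcond.
rewrite big_seq [RHS]big_seq; apply: eq_bigr => mu.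
rewrite mem_partns => /and3P[_ mu0 /eqP mun].
rewrite /= mmapZ /power_sum rmorph_prod /=.
have pE k : k \in mu ->
    mmap (@ratr algC) x (\sum_(j < N) 'X_j ^+ k) = (k != 1%N)%:R.
  move=> kmu; have := le_sumn _ _ kmu; rewrite mun.
  case: k kmu => [|k] kmu kn; first by rewrite kmu in mu0.
  rewrite rmorph_sum -[(k.+1 != 1)%N]/(k != 0%N) -lt0n -px ?/T; last by lia.
  by apply: eq_bigr => i _; rewrite rmorphXn -(xE i).
case: ifP => [mu1|/negbFE mu1].
  rewrite big_seq big1 ?mulr1 // => k kmu; rewrite pE //.
  by case: eqP kmu mu1 => // -> ->.
by rewrite (big_rem _ mu1) /= pE // mul0r mulr0.
Qed.

(** * Hook lengths *)

(* Appending a last row v only changes the hook lengths in the first v columns,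
   and the product of these telescopes. *)
Lemma prod_hooks_first_row m (t : seq nat) : sorted geq (m :: t) ->
  ((\prod_(1 <= j < m.+1) (m - j + count (leq j) t + 1)) *
   (\prod_(s < size t) (m - nth 0 t s + s.+1)) = (m + size t)`!)%N.
Proof.
elim/last_ind: t => [|t v IHt].
  move=> _; rewrite big_ord0 muln1 addn0 fact_prod big_nat_rev /=.
  by apply: eq_big_nat => j /andP[j1 jm]; lia.
rewrite -rcons_cons => srt.
have srt' : sorted geq (m :: t).
  by move: srt; rewrite -cats1 => /cat_sorted2[].
have {srt} ge_v i : i \in m :: t -> (v <= i)%N.
  move=> imt; have := sorted_ltn_nth (leT := geq) _ 0%N srt.
  move/(_ (fun a b c ba cb => leq_trans cb ba) (index i (m :: t)) (size (m :: t))).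
  rewrite !inE size_rcons ltnS index_size ltnSn index_mem imt => /(_ isT isT isT).
  by rewrite !nth_rcons index_mem imt nth_index // ltnn eqxx.
have vm : (v <= m)%N by apply: ge_v; rewrite mem_head.
move: {IHt} (IHt srt') => IH.
rewrite size_rcons big_ord_recr /= nth_rcons ltnn eqxx.
rewrite [X in (_ * (X * _))%N](eq_bigr
  (fun s : 'I__ => m - nth 0 t s + s.+1)%N); last first.
  by move=> s _; rewrite nth_rcons ltn_ord.
rewrite [(m + _.+1)%N]addnS factS -IH mulnA mulnAC [RHS]mulnA; congr (_ * _)%N.
have all_t j : (j <= v)%N -> count (leq j) t = size t.
  move=> jv; apply/eqP; rewrite -all_count; apply/allP => i it.
  by apply: leq_trans jv (ge_v _ _); rewrite inE it orbT.
rewrite !(@big_cat_nat _ _ _ v.+1 1 m.+1) //= mulnAC [RHS]mulnA.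
congr (_ * _)%N; last first.
  apply: eq_big_nat => j /andP[vj _]; rewrite -cats1 count_cat /=.
  by rewrite leqNgt vj !addn0.
transitivity ((\prod_(1 <= j < v.+1) (m - j + size t + 2)) * (m - v + (size t).+1))%N.
  congr (_ * _)%N; apply: eq_big_nat => j /andP[_ jv].
  by rewrite ltnS in jv; rewrite -cats1 count_cat /= all_t // jv; lia.
transitivity ((m + size t).+1 * \prod_(1 <= j < v.+1) (m - j + size t + 1))%N; last first.
  by congr (_ * _)%N; apply: eq_big_nat => j /andP[_ jv]; rewrite all_t.
elim: v vm {srt' IH ge_v all_t} => [_|v IHv vm].
  by rewrite !big_geq // mul1n muln1; lia.
rewrite !(@big_nat_recr _ _ _ v.+1 1) //= [RHS]mulnA -IHv; last exact: ltnW.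
by rewrite -!mulnA; congr (_ * (_ * _))%N; lia.
Qed.

Lemma nth_partition_mono la i j : sorted geq la -> (i <= j)%N ->
  (nth 0 la j <= nth 0 la i)%N.
Proof.
move=> srt ij; have [js|sj] := ltnP j (size la); last by rewrite nth_default.
have geq_tr : transitive geq by move=> a b c ba cb; apply: leq_trans cb ba.
by apply: (sorted_leq_nth geq_tr leqnn 0%N srt); rewrite ?inE ?(leq_ltn_trans ij).
Qed.

Section Hooks.

Variable la : seq nat.
Hypothesis la_sorted : sorted geq la.

(* The strictly decreasing sequence la + delta, with rows counted from 0. *)
Let L i := (nth 0 la i + (size la - i.+1))%N.

(** Hook lengths in row [i] depend only on this row and those below, so [prod_hooks_first_row]
    applies to [drop i la]. *)
Lemma prod_row_hooks i : (i < size la)%N ->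
  ((\prod_(1 <= j < (part la i.+1).+1) hook la i.+1 j) *
   (\prod_(s < size la | (i < s)%N) (L i - L s)) = (L i)`!)%N.
Proof.
move=> il; pose t := drop i.+1 la.
have srt : sorted geq (nth 0%N la i :: t).
  by rewrite -drop_nth //; apply: drop_sorted.
have szt : size t = (size la - i.+1)%N by rewrite size_drop.
rewrite /L -{2}szt -(prod_hooks_first_row srt); congr (_ * _)%N.
  apply: eq_big_nat => j /andP[_ jla]; rewrite /hook /part /= /conj_part.
  congr (_ + _ + _)%N; rewrite -{1}(cat_take_drop i.+1 la) count_cat.
  have /eqP-> : count (leq j) (take i.+1 la) == i.+1.
    rewrite -{2}(size_takel il) -all_count; apply/(all_nthP 0%N) => k.
    rewrite size_takel // => ki; rewrite nth_take //.
    by have := nth_partition_mono la_sorted (ki : k <= i)%N;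
      move: jla; rewrite /part /=; lia.
  by rewrite addKn.
rewrite -(big_mkord xpredT (fun s => (nth 0 la i - nth 0 t s + s.+1)%N)) szt.
rewrite -(big_mkord (fun s => i < s)%N
  (fun s => nth 0 la i + (size la - i.+1) - (nth 0 la s + (size la - s.+1)))%N).
rewrite (@big_cat_nat _ _ _ i.+1) //= big_nat_cond big_pred0 ?mul1n; last first.
  by move=> s; lia.
rewrite -{1}[i.+1]add0n big_addn; rewrite [LHS]big_nat_cond [RHS]big_nat_cond.
apply: eq_big => s; first by lia.
move=> /andP[/andP[_ sl] _]; rewrite nth_drop (addnC s).
have le_i : (i <= i.+1 + s)%N by lia.
by have := nth_partition_mono la_sorted le_i; lia.
Qed.

(* t lists, upwards from row i - 1, the rows of the complement, so that after
   rotation it lies below row i. *)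
Lemma prod_row_cohooks i : (i < size la)%N ->
  ((\prod_((part la i.+1).+1 <= j < (part la 1).+1) cohook la i.+1 j) *
   (\prod_(s < size la | (s < i)%N) (L s - L i)) =
   (nth 0 la 0 - nth 0 la i + i)`!)%N.
Proof.
move=> il; pose t := rev (map (subn (nth 0%N la 0)) (take i la)).
have szt : size t = i by rewrite size_rev size_map size_takel // ltnW.
have nth_t s : (s < i)%N -> nth 0%N t s = (nth 0 la 0 - nth 0 la (i - s.+1))%N.
  move=> si; rewrite nth_rev ?size_map ?size_takel ?(ltnW il) //.
  by rewrite (nth_map 0%N) ?size_takel ?(ltnW il) ?nth_take //; lia.
have srt : sorted geq ((nth 0 la 0 - nth 0 la i)%N :: t).
  apply/(pathP 0%N) => s; rewrite szt => si.
  have m1 := @nth_partition_mono la (i - s.+1) (i - s) la_sorted.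
  case: s si m1 => [|s] si m1.
    by rewrite nth_t //= ; rewrite subn0 in m1; have := m1 (leq_subr _ _); lia.
  by rewrite /= !nth_t //; [have := m1 (leq_sub2l _ (leqnSn _)); lia | lia].
have := prod_hooks_first_row srt; rewrite szt => <-; congr (_ * _)%N.
  have := @nth_partition_mono la 0 i la_sorted isT; rewrite /part /= => la_i.
  rewrite -{1}[(nth 0%N la i).+1]add1n big_addn big_nat_rev /= subSn // addnC.
  apply: eq_big_nat => j /andP[j1 jla]; rewrite /cohook /part /= /conj_part.
  set j' := ((_ - _).+1 + 1 - j.+1 + _)%N.
  (* Here [j'] is [part la 1 + 1 - j], as rotation reverses the columns. Both sides count the rows
     above [i] that are shorter than [j']. *)
  suff -> : (i.+1 - 1 - count (leq j') la = count (leq j) t)%N.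
    by congr (_ + _ + _)%N; rewrite /j'; lia.
  rewrite subn1 /=.
  rewrite -{1}(cat_take_drop i la) count_cat.
  have -> : count (leq j') (drop i la) = 0%N.
    apply/eqP; rewrite -leqn0 leqNgt -has_count; apply/(has_nthP 0%N) => -[k _].
    by rewrite nth_drop leqNgt /j' => /negP[];
      have := @nth_partition_mono la i (i + k) la_sorted (leq_addr _ _); lia.
  rewrite addn0 /t count_rev count_map -{1}(size_takel (ltnW il)).
  rewrite -(count_predC (leq j') (take i la)) addKn; apply: eq_in_count => x xt /=.
  have : (x <= nth 0 la 0)%N.
    have xla := mem_take xt; rewrite -(nth_index 0%N xla).
    exact: nth_partition_mono.
  by rewrite -ltnNge /j'; lia.
rewrite -(big_mkord xpredT (fun s => (nth 0 la 0 - nth 0 la i - nth 0 t s + s.+1)%N)).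
rewrite -(big_mkord (fun s => s < i)%N (fun s => L s - L i)%N).
rewrite (@big_cat_nat _ _ _ i) ?(ltnW il) //= [X in (_ * X)%N]big_nat_cond.
rewrite [X in (_ * X)%N]big_pred0 ?muln1; last by move=> s; lia.
rewrite big_nat_rev /= [LHS]big_nat_cond [RHS]big_nat_cond.
apply: eq_big => s; first by lia.
move=> /andP[/andP[_ si] _]; rewrite nth_t // /L.
have -> : (0 + i - s.+1 = i - s.+1)%N by [].
have := @nth_partition_mono la 0 (i - s.+1) la_sorted isT.
have := @nth_partition_mono la (i - s.+1) i la_sorted (leq_subr _ _).
by lia.
Qed.
End Hooks.

(** * Evaluation of the determinant *)

(** The coefficients of exp(-t); [dser] gives their partial sums. *)
Definition alt_exp (m : nat) : rat := (-1) ^+ m / m`!%:R.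

Lemma shift_dserS a c :
  shift dser a c = shift dser a c.+1 + shift alt_exp a c.
Proof.
rewrite /shift; case: (ltngtP c a) => [lt_ca|lt_ac|->].
- rewrite -[(a - c)%N](subnSK lt_ca) /dser big_ord_recr /= -/(dser _).
  by rewrite /alt_exp subnSK.
- by rewrite addr0.
by rewrite subnn add0r /dser big_ord1.
Qed.

(** The quotient a! / (a - c)! is a falling factorial, and (-1)^c times it is the rising factorial
    polynomial at -a. For c > a it vanishes, as [shift] does. *)
Lemma shift_alt_exp a c :
  shift alt_exp a c = alt_exp a * (\prod_(t < c) ('X + t%:R%:P)).[- a%:R].
Proof.
rewrite horner_prod.
have -> : \prod_(t < c) ('X + t%:R%:P : {poly rat}).[- a%:R] =
    (-1) ^+ c * (a ^_ c)%:R.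
  elim: c => [|c IHc]; first by rewrite big_ord0 mul1r ffactn0.
  rewrite big_ord_recr /= IHc hornerD hornerX hornerC ffactnSr natrM exprS.
  have [ca|ac] := leqP c a; first by rewrite natrB //; ring.
  by rewrite ffact_small // !(mul0r, mulr0).
rewrite /shift /alt_exp; have [ca|ac] := leqP c a; last first.
  by rewrite ffact_small ?mulr0.
have nz b : b`!%:R != 0 :> rat by rewrite pnatr_eq0 -lt0n fact_gt0.
rewrite -(ffact_fact ca) natrM.
have -> : (-1) ^+ a = (-1) ^+ (a - c) * (-1) ^+ c :> rat by rewrite -exprD subnK.
have nzf : (a ^_ c)%:R != 0 :> rat by rewrite pnatr_eq0 -lt0n ffact_gt0.
have e : (-1) ^+ c * (-1) ^+ c = 1 :> rat by rewrite -exprMn mulrNN mulr1 expr1n.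
transitivity ((-1) ^+ (a - c) * ((-1) ^+ c * (-1) ^+ c) / (a - c)`!%:R :> rat).
  by rewrite e mulr1.
by field; rewrite nz nzf.
Qed.

(** Factoring [alt_exp (a i)] out of row [i] leaves monic polynomials evaluated at -a_i. *)
Lemma det_shift_alt_exp n (a : 'I_n -> nat) :
  \det (\matrix_(i < n, j < n) shift alt_exp (a i) (n - j.+1)) =
  \prod_(i < n) (alt_exp (a i) *
    \prod_(j < n | (i < j)%N) ((a j)%:R - (a i)%:R)).
Proof.
pose p c : {poly rat} := \prod_(t < c) ('X + t%:R%:P).
have pmon c : p c \is monic.
  by apply: rpred_prod => t _; rewrite -(opprK t%:R%:P) -polyCN monicXsubC.
have psz c : size (p c) = c.+1.
  rewrite (_ : p c = \prod_(t < c) ('X - (- t%:R)%:P)) ?size_prod_XsubC.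
    by rewrite /index_enum -enumT size_enum_ord.
  by apply: eq_bigr => t _; rewrite polyCN opprK.
rewrite big_split /=.
under [X in _ * X]eq_bigr => i _ do under eq_bigr => j _ do
  rewrite -[(a j)%:R]opprK addrC.
rewrite -(@det_monic_poly _ _ p (fun i => - (a i)%:R)) //.
have <- : \det (diag_mx (\row_(i < n) alt_exp (a i))) = \prod_(i < n) alt_exp (a i).
  by rewrite det_diag; apply: eq_bigr => i _; rewrite mxE.
rewrite -det_mulmx; congr (\det _); apply/matrixP => i j.
by rewrite mul_diag_mx !mxE shift_alt_exp.
Qed.

(** Separates the factors involving [i]; what remains has the shape of a minor without row [i] in
    [det_shift_alt_exp]. *)
Lemma prod_lt_lift (R : comNzRingType) n (i : 'I_n.+1) (F : 'I_n.+1 -> R)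
    (D : 'I_n.+1 -> 'I_n.+1 -> R) :
  \prod_(a < n.+1) (F a * \prod_(b < n.+1 | (a < b)%N) D a b) =
  (F i * \prod_(b < n.+1 | (i < b)%N) D i b *
    \prod_(a < n.+1 | (a < i)%N) D a i) *
  \prod_(a < n) (F (lift i a) *
     \prod_(b < n | (a < b)%N) D (lift i a) (lift i b)).
Proof.
rewrite (bigD1_ord i) //= -[in RHS]mulrA; congr (_ * _).
rewrite [\prod_(a < n.+1 | _) _]big_mkcond (bigD1_ord i) //= ltnn mul1r.
rewrite -big_split; apply: eq_bigr => a _ /=; rewrite mulrCA; congr (_ * _).
rewrite big_mkcond (bigD1_ord i) //=; congr (_ * _).
rewrite [RHS]big_mkcond; apply: eq_bigr => b _.
by rewrite /= !ltnNge leq_bump2.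
Qed.

Lemma jtdet_dser n (l : nat -> nat) : let L i := (l i + (n.+1 - i.+1))%N in
  jtdet dser l n.+1 = \sum_(i < n.+1) (-1) ^+ i * shift dser (l i) i *
    \prod_(a < n) (alt_exp (L (lift i a)) *
      \prod_(b < n | (a < b)%N) ((L (lift i b))%:R - (L (lift i a))%:R)).
Proof.
move=> L.
(* The first column of [E] is kept and the others are differences of neighbours; multiplying by [U]
   undoes this by partial sums. *)
pose E := \matrix_(i < n.+1, j < n.+1)
  (if j == ord0 then shift dser (L i) n else shift alt_exp (L i) (n - j)).
pose U : 'M[rat]_n.+1 := \matrix_(k < n.+1, j < n.+1) (k <= j)%:R.
have sL i j : (i <= n)%N -> (j <= n)%N ->
      shift dser (l i + j) i = shift dser (L i) (n - j).
  move=> i_n j_n; rewrite /shift /L.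
  have -> : (n - j <= l i + (n.+1 - i.+1))%N = (i <= l i + j)%N by lia.
  by case: ifP => // _; congr dser; lia.
have detU : \det U = 1.
  rewrite -det_tr det_trig; first by rewrite big1 // => i _; rewrite !mxE leqnn.
  by apply/is_trig_mxP => i j ij; rewrite !mxE leqNgt ij.
have EU : \matrix_(i < n.+1, j < n.+1) shift dser (l i + j) i = E *m U.
  apply/matrixP => i j; rewrite !mxE (sL i j (ltn_ord i) (ltn_ord j)).
  rewrite big_ord_recl !mxE /= mulr1.
  transitivity (shift dser (L i) n +
    \sum_(k < n | (k < j)%N) shift alt_exp (L i) (n - k.+1)).
    have : (j <= n)%N by rewrite -ltnS.
    elim: {j} (nat_of_ord j) => [|j IHj] jn.
      by rewrite subn0 big_pred0 ?addr0 // => k.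
    rewrite shift_dserS subnSK // IHj ?(ltnW jn) // -addrA; congr (_ + _).
    rewrite [RHS](bigD1 (Ordinal jn)) //= addrC; congr (_ + _).
    by apply: eq_bigl => k; rewrite -val_eqE /=; lia.
  congr (_ + _); rewrite big_mkcond; apply: eq_bigr => k _.
  rewrite !mxE /= /bump add1n; case: ifP => _; first by rewrite mulr1.
  by rewrite mulr0.
rewrite /jtdet EU det_mulmx detU mulr1 (expand_det_col _ ord0).
apply: eq_bigr => i _; rewrite !mxE eqxx /cofactor addn0 mulrCA mulrA.
congr (_ * _).
  by have := sL i 0%N (ltn_ord i) isT; rewrite addn0 subn0 => ->.
rewrite -(det_shift_alt_exp (fun a => L (lift i a))); congr (\det _).
by apply/matrixP => a b; rewrite !mxE /= /bump add1n.
Qed.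

Lemma prod_gt_ord (R : comNzRingType) n a (F : nat -> R) :
  \prod_(b < n | (a < b)%N) F b = \prod_(a.+1 <= b < n) F b.
Proof. by rewrite big_geq_mkord. Qed.

(** By [prod_row_hooks], the hook product times the product of all [A a] is a sign. The minor
    without row [i] lacks the factors involving [i], which the row formulas turn into hooks and
    cohooks of row [i]. *)
Lemma hook_prod_jtdet la : sorted geq la -> (0 < size la)%N ->
  (hook_prod la)%:R * jtdet dser (nth 0%N la) (size la) =
  (-1) ^+ sumn la * \sum_(i < size la)
    (-1) ^+ nth 0%N la i * shift dser (nth 0%N la i) i
    / (nth 0 la 0 - nth 0 la i + i)`!%N%:R * (ext_hook_prod la i.+1)%:R.
Proof.
move=> srt la_gt0.
pose rowh i := (\prod_(1 <= j < (part la i.+1).+1) hook la i.+1 j)%N.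
pose coh i := (\prod_((part la i.+1).+1 <= j < (part la 1).+1) cohook la i.+1 j)%N.
pose f i := (nth 0 la 0 - nth 0 la i + i)%N.
pose L i := (nth 0 la i + (size la - i.+1))%N.
pose D a b : rat := (L b)%:R - (L a)%:R.
pose A a := alt_exp (L a) * \prod_(b < size la | (a < b)%N) D a b.
have nz b : b`!%:R != 0 :> rat by rewrite pnatr_eq0 -lt0n fact_gt0.
have LB a b : (a < b)%N -> (b < size la)%N -> D a b = - (L a - L b)%N%:R.
  move=> ab bl; have := nth_partition_mono srt (ltnW ab).
  by move=> ?; rewrite natrB ?opprB // /L; lia.
(* The signs (-1)^(L a) and (-1)^(size la - a - 1) combine to (-1)^(la_a) by the definition of
   [L]. *)
have Arow a : (a < size la)%N -> A a * (rowh a)%:R = (-1) ^+ nth 0%N la a.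
  move=> al; pose P : rat := \prod_(b < size la | (a < b)%N) (L a - L b)%N%:R.
  have rowL : (rowh a)%:R * P = (L a)`!%:R.
    by rewrite /L -(prod_row_hooks srt al) natrM [X in _ = _ * X]natr_prod.
  have -> : A a = alt_exp (L a) * ((-1) ^+ (size la - a.+1) * P).
    congr (_ * _).
    rewrite /P (eq_bigr (fun b : 'I_(size la) => -1 * (L a - L b)%N%:R)); last first.
      by move=> b ab; rewrite LB // mulN1r.
    by rewrite big_split /= (prod_gt_ord _ _ (fun=> -1)) prodr_const_nat.
  have := nz (L a); rewrite /alt_exp -rowL mulf_eq0 negb_or => /andP[nzr nzP].
  transitivity ((-1) ^+ L a * (-1) ^+ (size la - a.+1) : rat).
    by field; rewrite nzr nzP.
  by rewrite /L exprD -mulrA -exprMn mulrNN mulr1 expr1n mulr1.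
have Ccoh i : (i < size la)%N ->
    \prod_(a < size la | (a < i)%N) D a i * (coh i)%:R = (-1) ^+ i * (f i)`!%:R.
  move=> il; rewrite /f -(prod_row_cohooks srt il) natrM [X in _ * (_ * X)]natr_prod.
  rewrite (eq_bigr (fun a : 'I_(size la) => -1 * (L a - L i)%N%:R)); last first.
    by move=> a ai; rewrite LB // mulN1r.
  rewrite big_split /= (eq_bigl (fun a : 'I_(size la) => (a < i)%N)) //.
  have -> : \prod_(a < size la | (a < i)%N) (-1) = (-1) ^+ i :> rat.
    by rewrite -(big_ord_widen _ (fun=> -1) (ltnW il)) prodr_const card_ord.
  by rewrite -mulrA; congr (_ * _); rewrite mulrC.
have hooksE : (hook_prod la)%:R * \prod_(a < size la) A a = (-1) ^+ sumn la.
  rewrite /hook_prod big_add1 big_mkord natr_prod -big_split /= sumn_nth.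
  rewrite (big_morph _ (exprD (-1)) (expr0 _)); apply: eq_bigr => a _.
  by rewrite mulrC Arow.
move: hooksE Arow Ccoh; rewrite {LB}/A /D /L {A D L}.
case: (size la) la_gt0 => // n _; pose L i := (nth 0 la i + (n.+1 - i.+1))%N.
pose D a b : rat := (L b)%:R - (L a)%:R.
pose A a := alt_exp (L a) * \prod_(b < n.+1 | (a < b)%N) D a b.
move=> hooksE Arow Ccoh; rewrite jtdet_dser !mulr_sumr; apply: eq_bigr => i _.
rewrite -hooksE (prod_lt_lift i (fun a => alt_exp (L a)) D) -/(A i).
have Ai := Arow i (ltn_ord i); have Ci := Ccoh i (ltn_ord i).
set sh := shift _ _ _; set M := \prod_(a < n) _; set C := \prod_(a < _ | _) _ in Ci *.
have -> : (ext_hook_prod la i.+1)%:R = (rowh i)%:R * (coh i)%:R :> rat by rewrite -natrM.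
rewrite -/(f i).
have sq k : (-1) ^+ k * (-1) ^+ k = 1 :> rat by rewrite -exprMn mulrNN mulr1 expr1n.
(* Regrouped so that [Ai] and [Ci] apply; the sign (-1)^(la_i) then occurs twice and cancels. *)
transitivity ((hook_prod la)%:R * M * sh * (A i * (rowh i)%:R) *
  (-1) ^+ nth 0%N la i * (C * (coh i)%:R) / (f i)`!%:R); last by ring.
rewrite Ci -/(A i) in Ai *; rewrite Ai.
transitivity ((hook_prod la)%:R * M * sh * (-1) ^+ i *
  ((-1) ^+ nth 0%N la i * (-1) ^+ nth 0%N la i)).
  by rewrite sq; ring.
by field; rewrite nz.
Qed.

(** * Frobenius coordinates *)

(** A downward closed [P] holds on an initial segment of 1, ..., m, whose length is the count. *)
Lemma count_iota_downward (P : pred nat) m i :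
    (forall j, (0 < j)%N -> P j.+1 -> P j) -> (0 < i <= m)%N ->
  (i <= count P (iota 1 m))%N = P i.
Proof.
move=> Pdown; have Ple j k : (0 < j)%N -> (j <= k)%N -> P k -> P j.
  move=> j0; elim: k => [|k IHk]; first by rewrite leqn0 => /eqP->.
  rewrite leq_eqVlt => /predU1P[-> //|]; rewrite ltnS => jk Pk.
  by apply: IHk => //; apply: Pdown => //; apply: leq_trans j0 jk.
elim: m => [|m IHm] /andP[i0 im]; first by case: i i0 im.
rewrite -[m.+1]addn1 iotaD count_cat /= add1n addn0.
have cm : (count P (iota 1 m) <= m)%N.
  by rewrite -{2}(size_iota 1 m) count_size.
have [Pm|nPm] := boolP (P m.+1).
  have -> : count P (iota 1 m) = m.
    apply/eqP; rewrite -{2}(size_iota 1 m) -all_count; apply/allP => j.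
    by rewrite mem_iota => /andP[j1 jm]; apply: (Ple j m.+1) => //; lia.
  by rewrite addn1 im (Ple i m.+1).
rewrite addn0; move: im; rewrite leq_eqVlt => /predU1P[->|].
  by rewrite (negPf nPm) ltnNge cm.
by rewrite ltnS => im; apply: IHm; rewrite i0.
Qed.

Lemma leq_durfee la i : sorted geq la -> (0 < i <= size la)%N ->
  (i <= durfee la)%N = (i <= part la i)%N.
Proof.
move=> srt; apply: (count_iota_downward (P := fun i => i <= part la i)%N).
move=> j j0; rewrite /part /= => jla; apply: leq_trans (ltnW jla) _.
exact: nth_partition_mono srt (leq_pred j).
Qed.

(** In the boundary case i = part la i + 1 the conventional value -1 agrees with the general
    formula. *)
Lemma frob_aE la i : sorted geq la -> (0 < i <= size la)%N ->
  (i <= part la i + 1)%N -> frob_a la i = (part la i)%:Z - i%:Z.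
Proof.
move=> srt il le_i; rewrite /frob_a leq_durfee //; case: leqP => // lt_i.
by lia.
Qed.

Theorem theorem18 (n : nat) (la : seq nat) (n_ge1 : (1 <= n)%N)
    (la_partn : is_partn n la) :
  eta1 n la =
    (-1) ^+ n *
    \sum_(1 <= i < (size la).+1 | (i <= part la i + 1)%N)
      (-1) ^+ part la i * p_fix (part la 1) (frob_a la 1 - frob_a la i)
      * (ext_hook_prod la i)%:R.
Proof.
have /and3P[srt la0 /eqP lan] := la_partn.
have la_gt0 : (0 < size la)%N by case: (la) lan n_ge1 => //= <-.
have part1 : (0 < part la 1)%N.
  by rewrite lt0n; apply: contraNneq la0 => <-; rewrite /part mem_nth.
rewrite (eta1_jtdet la_partn) hook_prod_jtdet // lan; congr (_ * _).
rewrite big_add1 big_mkord [RHS]big_mkcond; apply: eq_bigr => i _.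
rewrite addn1 ltnS [part la i.+1]/(nth 0%N la i) /shift.
(* With rows counted from 0, i > la_i is exactly the range left out of the sum, where [shift] is
   0. *)
case: leqP => le_i; last by rewrite mulr0 !mul0r.
congr (_ * _); rewrite -mulrA; congr (_ * _).
have il := ltn_ord i.
have mono : (nth 0 la i <= nth 0 la 0)%N by apply: nth_partition_mono.
rewrite !frob_aE ?il ?la_gt0 ?addn1 //.
have -> : part la i.+1 = nth 0%N la i by [].
have -> : part la 1 = nth 0%N la 0%N by [].
have -> : (nth 0%N la 0%N)%:Z - 1%:Z - ((nth 0%N la i)%:Z - i.+1%:Z) =
  (nth 0 la 0 - nth 0 la i + i)%N%:Z by lia.
(* The number of fixed points is la_1 - la_i + i with this [i] counted from 0, which leaves la_i - i
   as the index of [dser]. *)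
rewrite p_fixE; last by lia.
by congr (dser _ / _); lia.
Qed.
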